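(* Let $\mathfrak{g}$ be a seven-dimensional oriented real Lie algebra with non-trivial center. Suppose there is a non-zero element $X$ in the center of $\mathfrak{g}$ such that $$\pi_*(\iota_X\kappa)\notin\Lambda_-(\mathfrak{h}^* )$$ for every closed $4$-form $\kappa\in\Lambda^4(\mathfrak{g}^* )$, where $\pi:\mathfrak{g}\to\mathfrak{h}=\mathfrak{g}/\mathrm{Span}\{X\}$ is the projection map. Then $\mathfrak{g}$ does not admit any coclosed $\mathrm{G}_2$-structure.
   Context: $d$ denotes the Chevalley–Eilenberg differential of a Lie algebra; ''closed'' means $d$-closed; $e^{ijk}=e^i\wedge e^j\wedge e^k$, etc. Since $X$ is central, $\mathfrak{h}=\mathfrak{g}/\mathrm{Span}\{X\}$ is a Lie algebra. Since $\iota_X(\iota_X\kappa)=0$, there is a unique $3$-form on $\mathfrak{h}$, denoted $\pi_*(\iota_X\kappa)$, with $\pi^*(\pi_*(\iota_X\kappa))=\iota_X\kappa$. For a $6$-dimensional real vector space $V$ and $\rho\in\Lambda^3(V^* )$, fix a non-zero $\nu\in\Lambda^6(V^* )$ and let $K_\rho:V\to V$ be the linear map defined by $\iota_{K_\rho(x)}\nu=\iota_x\rho\wedge\rho$; set $\lambda(\rho)=\frac16\mathrm{trace}(K_\rho^2)$. The sign of $\lambda(\rho)$ does not depend on $\nu$. Then $\Lambda_-(V^* )=\{\rho\in\Lambda^3(V^* ):\lambda(\rho)<0\}$; equivalently, it is the $\mathrm{GL}(V)$-orbit of forms expressible as $-f^{246}+f^{136}+f^{145}+f^{235}$ in some coframe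 $\{f^1,\dots,f^6\}$ of $V^*$. A $\mathrm{G}_2$-structure on a $7$-dimensional real Lie algebra $\mathfrak{g}$ is a positive $3$-form $\varphi\in\Lambda^3(\mathfrak{g}^* )$, i.e. one for which there is a coframe $\{e^1,\dots,e^7\}$ of $\mathfrak{g}^*$ with $\varphi=e^{127}+e^{347}+e^{567}+e^{135}-e^{146}-e^{236}-e^{245}$. It determines the inner product making $\{e^i\}$ orthonormal and the orientation $e^{1\cdots7}$, and its Hodge dual is $\phi=\star_\varphi\varphi=e^{1234}+e^{1256}+e^{1367}+e^{1457}+e^{2357}-e^{2467}+e^{3456}$. It is coclosed if $d\phi=0$. *)

(* Defs.v *)
From HB Require Import structures.
From mathcomp Require Import all_boot all_order all_algebra all_fingroup.
From mathcomp Require Import generic_quotient ring_quotient.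
From mathcomp Require Import boolp classical_sets functions reals.

Set Implicit Arguments.
Unset Strict Implicit.
Unset Printing Implicit Defensive.

Import Order.TTheory GRing.Theory Num.Theory.
Local Open Scope ring_scope.

HB.mixin Record Vector_isLieAlgebra (R : fieldType) (g : Type)
    of Vector R g := {
  lie : g -> g -> g;
  lie_linearl : forall y, linear (lie^~ y);
  lie_linearr : forall x, linear (lie x);
  liexx : forall x, lie x x = 0;
  lie_jacobi : forall x y z,
    lie x (lie y z) + lie y (lie z x) + lie z (lie x y) = 0
}.

#[short(type="lieAlgType")]
HB.structure Definition LieAlgebra (R : fieldType) :=
  { g of Vector_isLieAlgebra R g & Vector R g }.

Definition central (R : fieldType) (g : lieAlgType R) (X : g) : Prop :=
  forall Y : g, lie X Y = 0.

(* The quotient V / U.  Its Zmodule structure is that of ring_quotient; the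
   scaling and the finite dimension are added here. *)
Section QuotientSpace.
Variables (R : fieldType) (V : vectType R) (U : {vspace V}).
Local Open Scope quotient_scope.

Definition quotv : Type := Quotient.quot (pred_of_vspace U : zmodClosed V).

HB.instance Definition _ := GRing.Zmodule.on quotv.
HB.instance Definition _ := EqQuotient.on quotv.

Definition quotv_pi (v : V) : quotv := \pi_quotv v.

Lemma quotv_piE x y : (quotv_pi x == quotv_pi y) = (x - y \in U).
Proof. by rewrite (Quotient.idealrBE (pred_of_vspace U : zmodClosed V)). Qed.

Lemma quotv_reprK (q : quotv) : quotv_pi (repr q) = q.
Proof. exact: reprK. Qed.

Lemma quotv_piD x y : quotv_pi (x + y) = quotv_pi x + quotv_pi y.
Proof. exact: (Quotient.pi_add (pred_of_vspace U : zmodClosed V)). Qed.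

Definition quotv_scale (a : R) (q : quotv) : quotv := quotv_pi (a *: repr q).

Lemma quotv_piZ a x : quotv_pi (a *: x) = quotv_scale a (quotv_pi x).
Proof.
apply/eqP; rewrite quotv_piE -scalerBr rpredZ // -quotv_piE.
by rewrite quotv_reprK.
Qed.

Fact quotv_scaleA a b q :
  quotv_scale a (quotv_scale b q) = quotv_scale (a * b) q.
Proof. by rewrite -(quotv_reprK q) -!quotv_piZ scalerA. Qed.

Fact quotv_scale1 : left_id 1 quotv_scale.
Proof. by move=> q; rewrite -(quotv_reprK q) -!quotv_piZ scale1r. Qed.

Fact quotv_scaleDr : right_distributive quotv_scale +%R.
Proof.
move=> a p q; rewrite -(quotv_reprK p) -(quotv_reprK q).
by rewrite -quotv_piD -!quotv_piZ scalerDr quotv_piD.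
Qed.

Fact quotv_scaleDl q : {morph quotv_scale^~ q : a b / a + b}.
Proof.
by move=> a b; rewrite -(quotv_reprK q) -!quotv_piZ scalerDl quotv_piD.
Qed.

HB.instance Definition _ := GRing.Zmodule_isLmodule.Build R quotv
  quotv_scaleA quotv_scale1 quotv_scaleDr quotv_scaleDl.

Fact quotv_pi_is_linear : linear quotv_pi.
Proof. by move=> a x y; rewrite quotv_piD quotv_piZ. Qed.

HB.instance Definition _ := GRing.isSemilinear.Build R V quotv _ quotv_pi
  (GRing.semilinear_linear quotv_pi_is_linear).

Fact quotv_vect_iso : Vector.axiom (\dim U^C) quotv.
Proof.
pose c x : V := x - projv U x.
have cU x : c x \in (U^C)%VS by exact: memv_projC.
have c_lin : linear c by move=> a x y; rewrite /c linearP scalerBr opprD addrACA.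
have cE x y : x - y \in U -> c x = c y.
  move=> /projv_id; rewrite linearB /= => e.
  by apply/eqP; rewrite subr_eq addrAC -addrA e addrC subrK.
have c_pi x : c (repr (quotv_pi x)) = c x.
  by apply: cE; rewrite -quotv_piE quotv_reprK.
have cK q : quotv_pi (c (repr q)) = q.
  rewrite -[RHS]quotv_reprK; apply/eqP; rewrite quotv_piE -opprB rpredN.
  by rewrite opprB addrC subrK memv_proj.
exists (fun q => \row_i coord (vbasis U^C) i (c (repr q))).
  move=> a p q; rewrite -(quotv_reprK p) -(quotv_reprK q).
  have <- : quotv_pi (a *: repr p + repr q)
             = a *: quotv_pi (repr p) + quotv_pi (repr q) by exact: linearP.
  by apply/rowP=> i; rewrite !mxE !c_pi c_lin linearP.
exists (fun rw : 'rV_(\dim U^C) => quotv_pi (\sum_i rw 0 i *: (vbasis U^C)`_i)).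
  move=> q /=; rewrite -[RHS]cK; congr quotv_pi.
  rewrite [RHS](coord_vbasis (cU _)).
  by apply: eq_bigr => i _; rewrite mxE.
move=> rw; apply/rowP=> i; rewrite mxE c_pi.
set s := \sum_i _.
have sU : s \in (U^C)%VS.
  by apply: rpred_sum => j _; rewrite rpredZ ?vbasis_mem ?memt_nth.
have ps : projv U s = 0.
  apply/eqP; rewrite -memv0 -(capv_compl U) memv_cap memv_proj /=.
  by have -> : projv U s = s - c s; [rewrite subKr | exact: rpredB].
by rewrite /c ps subr0 coord_sum_free ?(basis_free (vbasisP _)).
Qed.

HB.instance Definition _ := Lmodule_hasFinDim.Build R quotv quotv_vect_iso.

End QuotientSpace.

Section Forms.
Variables (R : realType) (V : vectType R).

Definition upd k (v : 'I_k -> V) (i : 'I_k) (x : V) : 'I_k -> V :=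
  fun j => if j == i then x else v j.

Definition multilinear k (w : ('I_k -> V) -> R^o) : Prop :=
  forall (v : 'I_k -> V) (i : 'I_k), linear (fun x => w (upd v i x)).

Definition alternating k (w : ('I_k -> V) -> R^o) : Prop :=
  forall (v : 'I_k -> V) (i j : 'I_k), i != j -> v i = v j -> w v = 0.

Definition is_form k : {pred ('I_k -> V) -> R^o} :=
  fun w => `[< multilinear w /\ alternating w >].

Fact is_form_submod k : submod_closed (@is_form k).
Proof.
split; first by apply/asboolP; split=> [v i a x y|v i j _ _] /=;
  rewrite /= ?scaler0 ?addr0.
move=> a w1 w2 /asboolP[m1 a1] /asboolP[m2 a2]; apply/asboolP; split.
  move=> v i b x y; rewrite !fctE /= m1 m2 !scalerDr !scalerA (mulrC a b).
  by rewrite addrACA.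
by move=> v i j ij vij; rewrite !fctE /= (a1 v i j) // (a2 v i j) // scaler0 addr0.
Qed.

HB.instance Definition _ k := GRing.isSubmodClosed.Build R (('I_k -> V) -> R^o)
  (@is_form k) (@is_form_submod k).

(* k-forms on V, as alternating k-linear maps V^k -> R *)
Record altform k := Form {
  form_fun :> ('I_k -> V) -> R^o;
  _ : is_form form_fun
}.
HB.instance Definition _ k := [isSub for @form_fun k].
HB.instance Definition _ k := [Choice of altform k by <:].
HB.instance Definition _ k := [SubChoice_isSubLmodule of altform k by <:].

Lemma form_lin k (w : altform k) : multilinear w.
Proof. by case: w => w /= /asboolP[]. Qed.

Lemma form_alt k (w : altform k) : alternating w.
Proof. by case: w => w /= /asboolP[]. Qed.

Let scaleRE (p : R) (q : R^o) : p *: q = p * q. Proof. by []. Qed.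

Lemma upd_comp k l (f : 'I_l -> 'I_k) (v : 'I_k -> V) i x (j : 'I_l) :
  injective f -> f j = i -> upd v i x \o f = upd (v \o f) j x.
Proof.
by move=> fI <-; apply/funext => m; rewrite /upd /= (inj_eq fI).
Qed.

Lemma upd_comp_notin k l (f : 'I_l -> 'I_k) (v : 'I_k -> V) i x :
  (forall j, f j != i) -> upd v i x \o f = v \o f.
Proof. by move=> fi; apply/funext => m; rewrite /upd /= (negPf (fi m)). Qed.

Definition fcons k (x : V) (v : 'I_k -> V) : 'I_k.+1 -> V :=
  fun i => oapp v x (unlift ord0 i).

Lemma fcons_upd k x (v : 'I_k -> V) i y :
  fcons x (upd v i y) = upd (fcons x v) (lift ord0 i) y.
Proof.
apply/funext => j; rewrite /fcons /upd; case: unliftP => [m ->|->] /=.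
  by rewrite (inj_eq lift_inj).
by rewrite ?(negPf (neq_lift _ _)).
Qed.

Lemma fcons_lift k x (v : 'I_k -> V) i : fcons x v (lift ord0 i) = v i.
Proof. by rewrite /fcons liftK. Qed.

Definition fcat k l (u : 'I_k -> V) (v : 'I_l -> V) : 'I_(k + l) -> V :=
  fun i => match fintype.split i with inl a => u a | inr b => v b end.

Lemma fcat_upd k l (u : 'I_k -> V) (v : 'I_l -> V) i y :
  fcat u (upd v i y) = upd (fcat u v) (rshift k i) y.
Proof.
apply/funext => j; rewrite /fcat /upd; case: split_ordP => m -> /=.
  by rewrite eq_lrshift.
by rewrite eq_rshift.
Qed.

Lemma fcat_rshift k l (u : 'I_k -> V) (v : 'I_l -> V) i :
  fcat u v (rshift k i) = v i.
Proof.
by rewrite /fcat; case: split_ordP => m /eqP; rewrite ?eq_rshift ?eq_rlshift // => /eqP->.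
Qed.

(* interior product: x is inserted in the first slot *)
Fact iota_is_form k (x : V) (w : altform k.+1) :
  is_form (fun v : 'I_k -> V => w (fcons x v)).
Proof.
apply/asboolP; split=> [v i a y z|v i j ij vij].
  by rewrite !fcons_upd form_lin.
by apply: (@form_alt _ w _ (lift ord0 i) (lift ord0 j));
  rewrite ?(inj_eq lift_inj) ?fcons_lift.
Qed.

Definition iotaf k (x : V) (w : altform k.+1) : altform k :=
  Form (iota_is_form x w).

(* The normalization is the one for which the value of e^1 /\ ... /\ e^k at
   (v_1, ..., v_k) is det (e^i(v_j)). *)
Definition wedge_fun k l (a : altform k) (b : altform l)
    (v : 'I_(k + l) -> V) : R^o :=
  (k`! * l`!)%:R^-1 *
  \sum_(s : 'S_(k + l)) (-1) ^+ s *
     (a (fun i => v (s (lshift l i))) * b (fun j => v (s (rshift k j)))).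

Fact wedge_is_form k l (a : altform k) (b : altform l) :
  is_form (wedge_fun a b).
Proof.
apply/asboolP; split=> [v i c x y|v i j ij vij]; last first.
  rewrite /wedge_fun; set S := \sum_(s : 'S_(k + l)) _.
  suff SN : S = - S.
    by move/eqP: SN; rewrite -addr_eq0 -mulr2n mulrn_eq0 /= => /eqP->; rewrite mulr0.
  rewrite {1}/S (reindex_inj (mulIg (tperm i j))) /= -sumrN.
  apply: eq_bigr => s _; rewrite odd_permM odd_tperm ij addbT signrN mulNr.
  have vt m : v ((s * tperm i j)%g m) = v (s m).
    by rewrite permM; case: tpermP => [->|->|].
  by congr (- (_ * (_ * _))); congr (form_fun _ _); apply/funext => m; rewrite vt.
rewrite /wedge_fun scaleRE mulrCA -mulrDr; congr (_ * _).
rewrite mulr_sumr -big_split /=; apply: eq_bigr => s _.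
rewrite [X in _ = X + _]mulrCA -mulrDr; congr (_ * _).
have lI : injective (s \o @lshift k l) by move=> ? ? /perm_inj /lshift_inj.
have rI : injective (s \o @rshift k l) by move=> ? ? /perm_inj /rshift_inj.
have comp z : (a (fun i0 => upd v i z (s (lshift l i0))) *
               b (fun j => upd v i z (s (rshift k j)))) =
  a (upd v i z \o (s \o @lshift k l)) * b (upd v i z \o (s \o @rshift k l)).
  by [].
rewrite !comp; case: (split_ordP ((s^-1)%g i)) => m em.
  have sm : (s \o @lshift k l) m = i by rewrite /= -em permKV.
  have nr j : (s \o @rshift k l) j != i.
    by rewrite -sm /= (inj_eq perm_inj) eq_rlshift.
  by rewrite !(upd_comp _ _ lI sm) !(upd_comp_notin _ _ nr) form_lin mulrDl mulrA.
have sm : (s \o @rshift k l) m = i by rewrite /= -em permKV.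
have nl j : (s \o @lshift k l) j != i.
  by rewrite -sm /= (inj_eq perm_inj) eq_lrshift.
by rewrite !(upd_comp _ _ rI sm) !(upd_comp_notin _ _ nl) form_lin mulrDr mulrCA.
Qed.

Definition wedge k l (a : altform k) (b : altform l) : altform (k + l) :=
  Form (wedge_is_form a b).

Fact form1_is_form : is_form (fun _ : 'I_0 -> V => 1 : R^o).
Proof. by apply/asboolP; split=> ? []. Qed.

Fact coord_is_form n (E : n.-tuple V) (i : 'I_n) :
  is_form (fun v : 'I_1 -> V => coord E i (v ord0) : R^o).
Proof.
apply/asboolP; split=> [v j a x y|v j1 j2]; last by rewrite (ord1 j1) (ord1 j2) eqxx.
by rewrite /upd (ord1 j) eqxx linearP.
Qed.

(* The coframe (e^1, ..., e^n) dual to the basis E; every coframe of V^* is of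
   this form for a unique basis E of V. *)
Definition coframe n (E : n.-tuple V) (i : 'I_n) : altform 1 :=
  Form (coord_is_form E i).

(* coframe_form E [:: i; j; k] is e^{ijk}, with indices numbered from 1 *)
Fixpoint coframe_form n (E : n.+1.-tuple V) (s : seq nat) : altform (size s) :=
  if s is i :: s' then wedge (coframe E (inord i.-1)) (coframe_form E s')
  else Form form1_is_form.

(* Hodge star of the inner product for which E is orthonormal, with volume form
   vol: the contraction of vol with the k-vector metrically dual to a, so that
   a /\ hodge b = <a, b> vol. *)
Definition hodge_fun n (E : n.-tuple V) k l
    (vol : altform (k + l)) (a : altform k) (v : 'I_l -> V) : R^o :=
  k`!%:R^-1 * \sum_(i : {ffun 'I_k -> 'I_n})
    a (fun j => E`_(i j)) * vol (fcat (fun j => E`_(i j)) v).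

Fact hodge_is_form n (E : n.-tuple V) k l
    (vol : altform (k + l)) (a : altform k) :
  is_form (hodge_fun E vol a).
Proof.
apply/asboolP; split=> [v i c x y|v i j ij vij]; last first.
  rewrite /hodge_fun big1 ?mulr0 // => f _.
  rewrite (@form_alt _ vol _ (rshift k i) (rshift k j)) ?mulr0 //.
    by rewrite eq_rshift.
  by rewrite !fcat_rshift.
rewrite /hodge_fun scaleRE mulrCA -mulrDr; congr (_ * _).
rewrite mulr_sumr -big_split /=; apply: eq_bigr => f _.
by rewrite !fcat_upd form_lin mulrDr mulrCA.
Qed.

Definition hodge n (E : n.-tuple V) k l
    (vol : altform (k + l)) (a : altform k) : altform l :=
  Form (hodge_is_form E vol a).

End Forms.

Section Pullback.
Variables (R : realType) (V W : vectType R) (f : {linear V -> W}).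

Fact pullback_is_form k (w : altform W k) :
  is_form (fun v : 'I_k -> V => w (f \o v)).
Proof.
have fu (v : 'I_k -> V) i x : f \o upd v i x = upd (f \o v) i (f x).
  by apply/funext => j; rewrite /upd /=; case: eqP.
apply/asboolP; split=> [v i a x y|v i j ij vij].
  by rewrite !fu linearP form_lin.
by apply: (@form_alt _ _ _ w _ i j) => //=; rewrite vij.
Qed.

Definition pullback k (w : altform W k) : altform V k :=
  Form (pullback_is_form w).

End Pullback.

Section StableForms.
Variables (R : realType) (V : vectType R).

(* For dim V = 6 and nu != 0 the map x |-> iotaf x nu is an isomorphism onto the
   5-forms, so that Kmap nu rho is the unique K in the set below; the default
   value is not used. *)
Definition Kmap (nu : altform V 6) (rho : altform V 3) : 'End(V) :=
  xget 0 [set K : 'End(V) | forall x, iotaf (K x) nu = wedge (iotaf x rho) rho].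

Definition trace (K : 'End(V)) : R :=
  \tr (passmx.mxof (vbasis {:V}) (vbasis {:V}) K).

Definition lambda (nu : altform V 6) (rho : altform V 3) : R :=
  6%:R^-1 * trace (Kmap nu rho \o Kmap nu rho)%VF.

(* The sign of lambda nu rho does not depend on the choice of nu. *)
Definition Lambda_minus (rho : altform V 3) : Prop :=
  exists2 nu : altform V 6, nu != 0 & lambda nu rho < 0.
End StableForms.

(* the unique form on V / U that pulls back to w, when w is basic: see
   pushforwardP and pullback_quotv_inj *)
Definition pushforward (R : realType) (V : vectType R) (U : {vspace V}) k
    (w : altform V k) : altform (quotv U) k :=
  xget 0 [set r : altform (quotv U) k | pullback (@quotv_pi R V U) r = w].

Section PushforwardTheory.
Variables (R : realType) (V : vectType R).

Lemma upd_id k (v : 'I_k -> V) i : upd v i (v i) = v.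
Proof. by apply/funext => j; rewrite /upd; case: eqP => // ->. Qed.

Lemma pullback_quotv_inj (U : {vspace V}) k :
  injective (@pullback R V (quotv U) (@quotv_pi R V U) k).
Proof.
move=> r1 r2 r12; apply/val_inj/funext => q /=.
have -> : q = @quotv_pi R V U \o (fun i => repr (q i)).
  by apply/funext => i /=; rewrite quotv_reprK.
by have /(congr1 (fun r : altform V k => r (fun i => repr (q i)))) := r12.
Qed.

Lemma pushforwardP (U : {vspace V}) k (w : altform V k) :
  (forall v i, v i \in U -> w v = 0) ->
  pullback (@quotv_pi R V U) (pushforward U w) = w.
Proof.
move=> wU.
have w1 (v : 'I_k -> V) i x y : x - y \in U -> w (upd v i x) = w (upd v i y).
  move=> xyU; rewrite -[x](subrK y) -[x - y]scale1r form_lin.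
  by rewrite (wU _ i) ?scaler0 ?add0r // /upd eqxx.
have wE (v v' : 'I_k -> V) : (forall i, v i - v' i \in U) -> w v = w v'.
  move=> vv'; pose u m (i : 'I_k) := if (i < m)%N then v' i else v i.
  have uS m : (m <= k)%N -> w (u m) = w v.
    elim: m => [_|m IH mk]; first by congr (form_fun w _); apply/funext.
    rewrite -IH ?(ltnW mk) //.
    have -> : u m = upd (u m) (Ordinal mk) (v (Ordinal mk)).
      by rewrite -[LHS](upd_id _ (Ordinal mk)) /u /= ltnn.
    rewrite (w1 _ _ _ _ (vv' _)); congr (form_fun w _); apply/funext => i.
    rewrite /upd; case: eqP => [->|/eqP]; rewrite /u /= ?ltnSn //.
    by rewrite -val_eqE /= ltnS leq_eqVlt => /negPf->.
  rewrite -(uS k) //; congr (form_fun w _); apply/funext => i.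
  by rewrite /u ltn_ord.
apply: (@xgetPex _ 0 [set r | pullback (@quotv_pi R V U) r = w]%classic).
have piK (q : quotv U) x : q = quotv_pi U x -> repr q - x \in U.
  by move=> ->; rewrite -quotv_piE quotv_reprK.
have rP : is_form (fun q : 'I_k -> quotv U => w (fun i => repr (q i))).
  apply/asboolP; split=> [q i a x y|q i j ij qij].
    have urep z : (fun j => repr (upd q i z j)) = upd (fun j => repr (q j)) i (repr z).
      by apply/funext => j; rewrite /upd; case: eqP.
    rewrite !urep (w1 _ _ _ (a *: repr x + repr y)) ?form_lin //.
    by apply: piK; rewrite linearP /= !quotv_reprK.
  by rewrite (@form_alt _ _ _ w _ i j) //= qij.
exists (Form rP); apply/val_inj/funext => v /=.
by apply: wE => i; exact: piK.
Qed.

Lemma pushforward_iotaK k X (w : altform V k.+1) :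
  pullback (@quotv_pi R V <[X]>%VS) (pushforward <[X]>%VS (iotaf X w)) =
  iotaf X w.
Proof.
apply: pushforwardP => v i /vlineP[a vi] /=.
set l := lift ord0 i.
have w0 : w (upd (fcons X v) l 0) = 0.
  have := form_lin w (fcons X v) l (-1) 0 0.
  by rewrite scaler0 addr0 scaleN1r addNr.
rewrite -(upd_id v i) vi fcons_upd -/l -[a *: X]addr0 form_lin w0 addr0.
rewrite (@form_alt _ _ _ w (upd (fcons X v) l X) ord0 l) ?scaler0 ?neq_lift //.
by rewrite /upd eqxx (negPf (neq_lift _ _)) /fcons unlift_none.
Qed.

End PushforwardTheory.

Section ChevalleyEilenberg.
Variables (R : realType) (g : lieAlgType R).

(* The usual sum over pairs of slots i < j', where j' = lift i j and lift i (lift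
   j _) enumerates the remaining slots. *)
Definition ce_diff k (a : altform g k.+1) (v : 'I_k.+2 -> g) : R^o :=
  \sum_(i < k.+2) \sum_(j < k.+1 | (i <= j)%N)
    (-1) ^+ (i + lift i j) *
    a (fcons (lie (v i) (v (lift i j))) (fun m => v (lift i (lift j m)))).

Definition d_closed k (a : altform g k.+1) : Prop := forall v, ce_diff a v = 0.

End ChevalleyEilenberg.

Section G2.
Variables (R : realType) (g : lieAlgType R).
Local Notation e E s := (coframe_form E s%N).

Definition g2_form (E : 7.-tuple g) : altform g 3 :=
  e E [:: 1; 2; 7] + e E [:: 3; 4; 7] + e E [:: 5; 6; 7] + e E [:: 1; 3; 5]
  - e E [:: 1; 4; 6] - e E [:: 2; 3; 6] - e E [:: 2; 4; 5].

Definition adapted_frame (phi : altform g 3) (E : 7.-tuple g) : Prop :=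
  basis_of {:g} E /\ phi = g2_form E.

Definition G2_structure (phi : altform g 3) : Prop :=
  exists E : 7.-tuple g, adapted_frame phi E.

(* for E adapted to phi, the Hodge dual of phi with respect to the inner product
   and the orientation e^{1...7} that phi determines *)
Definition g2_dual (E : 7.-tuple g) (phi : altform g 3) : altform g 4 :=
  hodge E (e E [:: 1; 2; 3; 4; 5; 6; 7] : altform g (3 + 4)) phi.

(* All the frames E adapted to phi give the same Hodge dual. *)
Definition coclosed (phi : altform g 3) : Prop :=
  exists2 E : 7.-tuple g, adapted_frame phi E & d_closed (g2_dual E phi).
End G2.

(* an orientation, as a ray of volume forms *)
Definition orientation (R : realType) (V : vectType R)
    (o : set (altform V (\dim {:V}))) : Prop :=
  exists2 w : altform V (\dim {:V}), w != 0 &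
    o = [set w' : altform V (\dim {:V}) |
          exists2 c : R, 0 < c & w' = c *: w]%classic.

(* Main.v *)
(* Let E be a frame adapted to phi, X x Y its G2 cross product, psi the Hodge
   dual of phi and vol = e^{1...7}.  For all X and Y,
     iota_Y iota_X psi /\ iota_X psi = - 2 vol(X, X x Y, ...).
   Take rho and nu on h = g / <X> that pull back to iota_X psi and iota_X vol.
   Then K_rho is induced by Y |-> - 2 X x Y, and
   X x (X x Y) = <X, Y> X - |X|^2 Y gives K_rho^2 = - 4 |X|^2, so that
   lambda rho < 0 for every non-zero X.  Thus kappa := psi, which is closed when
   phi is coclosed, contradicts the hypothesis on X.

   Both identities are quadratic in X and linear in Y; they are checked on the
   integer coefficients of the frame, symmetrized in the two slots of X. *)
From HB Require Import structures.
Require Import Defs.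
From mathcomp Require Import all_boot all_order all_algebra all_fingroup.
From mathcomp Require Import boolp classical_sets functions reals.
From mathcomp Require Import ring.

Set Implicit Arguments.
Unset Strict Implicit.
Unset Printing Implicit Defensive.

Import Order.TTheory GRing.Theory Num.Theory passmx.
Local Open Scope ring_scope.

(** * Alternating forms: permuted arguments and expansion of wedge products *)

Section AlternatingForms.
Variables (R : realType) (V : vectType R).

Lemma form_ext k (w1 w2 : altform V k) : (forall v, w1 v = w2 v) -> w1 = w2.
Proof. by move=> w12; apply/val_inj/funext. Qed.

Lemma form_tperm k (w : altform V k) (v : 'I_k -> V) i j : i != j ->
  w (v \o tperm i j) = - w v.
Proof.
move=> ij; pose u x y := upd (upd v i x) j y.
have uii x : w (u x x) = 0.
  apply: (@form_alt _ _ _ w _ i j) => //.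
  by rewrite /u /upd eqxx (negPf ij) eqxx.
have uC x y : upd (upd v j y) i x = u x y.
  apply/funext => m; rewrite /u /upd; case: eqVneq => // ->.
  by rewrite (negPf ij).
have uD2 x y z : w (u x (y + z)) = w (u x y) + w (u x z).
  by rewrite -[y]scale1r form_lin !scale1r.
have uD1 x y z : w (u (x + y) z) = w (u x z) + w (u y z).
  by rewrite -!uC -[x]scale1r form_lin !scale1r.
(* Polarization: the value with [v i + v j] in both slots is zero, and so are its two diagonal
   terms. *)
have := uii (v i + v j).
rewrite uD1 !uD2 !uii add0r addr0 addrC => /eqP; rewrite addr_eq0 => /eqP E.
have -> : v \o tperm i j = u (v j) (v i).
  apply/funext => m; rewrite /u /upd /=; case: tpermP => [->|->|].
  - by rewrite eqxx (negPf ij).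
  - by rewrite eqxx.
  by move=> /eqP/negPf-> /eqP/negPf->.
by rewrite E /u !upd_id.
Qed.

Lemma form_perm k (w : altform V k) (s : 'S_k) (v : 'I_k -> V) :
  w (v \o s) = (-1) ^+ s * w v.
Proof.
have [ts -> dts] := prod_tpermP s.
elim: ts dts v => [_ v|[i j] ts IH /= /andP[ij dts] v].
  rewrite big_nil odd_perm1 mul1r; congr (form_fun w _).
  by apply/funext => m /=; rewrite perm1.
rewrite big_cons odd_mul_tperm ij signr_addb -mulrA -IH // expr1 mulN1r.
rewrite -(form_tperm _ _ ij); congr (form_fun w _).
by apply/funext => m /=; rewrite permM.
Qed.

Lemma fconsE k (v : 'I_k.+1 -> V) : v = fcons (v ord0) (v \o lift ord0).
Proof.
apply/funext => i; rewrite /fcons.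
by case: (unliftP ord0 i) => [j|] ->; rewrite ?liftK ?unlift_none.
Qed.

Lemma fcons_linear k (w : altform V k.+1) (v : 'I_k -> V) a x y :
  w (fcons (a *: x + y) v) = a * w (fcons x v) + w (fcons y v).
Proof.
pose v0 : 'I_k.+1 -> V := fun i => oapp v 0 (unlift ord0 i).
have fE z : fcons z v = upd v0 ord0 z.
  by apply/funext => i; rewrite /v0 /upd /fcons; case: unliftP => [j|] ->.
by rewrite !fE form_lin.
Qed.

Lemma fcons_sum k (w : altform V k.+1) (I : finType) (c : I -> R) (b : I -> V)
    (v : 'I_k -> V) :
  w (fcons (\sum_i c i *: b i) v) = \sum_i c i * w (fcons (b i) v).
Proof.
elim/big_rec2 : _ => [|i y1 y2 _ <-]; last exact: fcons_linear.
(* The empty sum: linearity with scalar -1 at 0 gives w(0) = - w(0) + w(0) = 0. *)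
by have := fcons_linear w v (-1) 0 0; rewrite scaler0 addr0 mulN1r addNr.
Qed.

(** A permutation amounts to the image i of 0 together with a permutation of the other points,
    renumbered by skipping 0 in the source and i in the target. *)
Lemma sum_perm_recl (T : nmodType) n (F : 'S_n.+1 -> T) :
  \sum_s F s = \sum_(i < n.+1) \sum_(t : 'S_n) F (lift_perm ord0 i t).
Proof.
rewrite pair_big /=.
rewrite (reindex (fun p : 'I_n.+1 * 'S_n => lift_perm ord0 p.1 p.2)) //=.
(* The default [k] is never taken, since [s (lift ord0 k)] differs from [s ord0]. *)
pose dec (s : 'S_n.+1) (k : 'I_n) :=
  odflt k (unlift (s ord0) (s (lift ord0 k))).
have decK (s : 'S_n.+1) k : lift (s ord0) (dec s k) = s (lift ord0 k).
  rewrite /dec; have := neq_lift ord0 k.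
  by rewrite -(can_eq (permK s)) => /unlift_some[] ? ? ->.
have dec_inj s : injective (dec s).
  by move=> i j /(congr1 (lift (s ord0))); rewrite !decK => /perm_inj/lift_inj.
exists (fun s : 'S_n.+1 => (s ord0, perm (@dec_inj s))) => [[i t] _|s _] /=.
  rewrite lift_perm_id; congr (_, _); apply/permP => k.
  by rewrite permE /dec lift_perm_id lift_perm_lift liftK.
apply/permP => k; case: (unliftP ord0 k) => [j|] ->; rewrite ?lift_perm_id //.
by rewrite lift_perm_lift permE decK.
Qed.

(** Laplace expansion: i is the argument that lands in the first slot of [a], and moving it there
    costs the sign (-1)^i. The factor 1/(k+1) is the quotient of the normalizations k! l! and (k+1)!
    l!. *)
Lemma wedge_recl k l (a : altform V k.+1) (b : altform V l) v :
  wedge a b v = k.+1%:R^-1 *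
    \sum_(i < (k + l).+1)
      (-1) ^+ i * wedge (iotaf (v i) a) b (v \o lift i).
Proof.
rewrite [LHS]/= /wedge_fun sum_perm_recl factS -mulnA natrM invfM -mulrA.
congr (_ * _); rewrite mulr_sumr; apply: eq_bigr => i _.
rewrite [in RHS]/= /wedge_fun mulrCA; congr (_ * _).
rewrite mulr_sumr; apply: eq_bigr => t _.
rewrite odd_lift_perm /= signr_addb signr_odd -mulrA; congr (_ * (_ * (_ * _))).
  rewrite [in LHS](fconsE (fun m => _)); congr (form_fun a (fcons _ _)).
    have -> : lshift l ord0 = ord0 :> 'I_(k.+1 + l) by apply: val_inj.
    by rewrite lift_perm_id.
  apply/funext => m /=.
  have -> : lshift l (lift ord0 m) = lift ord0 (lshift l m) :> 'I_(k.+1 + l).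
    exact: val_inj.
  by rewrite lift_perm_lift.
congr (form_fun b _); apply/funext => m.
have -> : rshift k.+1 m = lift ord0 (rshift k m) :> 'I_(k.+1 + l).
  exact: val_inj.
by rewrite /= lift_perm_lift.
Qed.

(** All l! permutations contribute the same term, because the sign cancels against the one from
    [form_perm]. *)
Lemma wedge0l l (a : altform V 0) (b : altform V l) (v : 'I_l -> V) :
  wedge a b v = a (fun=> 0) * b v.
Proof.
rewrite [LHS]/= /wedge_fun fact0 mul1n.
have aE u : a u = a (fun=> 0).
  by congr (form_fun a _); apply/funext => -[].
rewrite (eq_bigr (fun=> a (fun=> 0) * b v)) => [|s _].
  rewrite sumr_const card_Sn -[X in _ * X]mulr_natl mulKf //.
  by rewrite pnatr_eq0 -lt0n fact_gt0.
rewrite aE mulrCA; congr (_ * _).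
have -> : (fun j => v (s (rshift 0 j))) = v \o s.
  by apply/funext => j /=; congr (v (s _)); apply: val_inj.
by rewrite form_perm mulrA -signr_addb addbb mul1r.
Qed.

Lemma wedge_coframe n (E : n.-tuple V) i l (b : altform V l) v :
  wedge (coframe E i) b v =
    \sum_(m < l.+1) (-1) ^+ m * (coord E i (v m) * b (v \o lift m)).
Proof.
rewrite wedge_recl invr1 mul1r; apply: eq_bigr => m _.
by rewrite wedge0l /= /fcons unlift_none.
Qed.

(** The shape of iota_Y iota_X psi /\ iota_X psi. Expanding along both slots of [a] leaves 20 terms
    in place of 120 permutations. *)
Lemma wedge23 (a : altform V 2) (b : altform V 3) v :
  wedge a b v = 2%:R^-1 * \sum_(i < 5) (-1) ^+ i * (\sum_(j < 4) (-1) ^+ j *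
    (a (fcons (v i) (fcons (v (lift i j)) (fun=> 0))) *
     b (v \o lift i \o lift j))).
Proof.
rewrite wedge_recl; congr (_ * _); apply: eq_bigr => i _; congr (_ * _).
rewrite wedge_recl invr1 mul1r; apply: eq_bigr => j _.
by rewrite wedge0l.
Qed.

End AlternatingForms.

(** * Lists of indices *)

Definition rem_at (T : Type) i (l : seq T) := take i l ++ drop i.+1 l.

(** On [iota 0 n] these are the increasing multi-indices, whose values determine a k-form
    ([form_ext_combs]). *)
Fixpoint combs (T : Type) k (s : seq T) : seq (seq T) :=
  if k is k'.+1 then
    if s is x :: s' then map (cons x) (combs k' s') ++ combs k s' else [::]
  else [:: [::]].

Fixpoint words n k : seq (seq nat) :=
  if k is k'.+1 then [seq x :: l | x <- iota 0 n, l <- words n k']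
  else [:: [::]].

Lemma size_rem_at (T : Type) i (l : seq T) k :
  size l = k.+1 -> (i < k.+1)%N -> size (rem_at i l) = k.
Proof.
by move=> sl ik; rewrite size_cat size_drop size_take sl ik subSS subnKC.
Qed.

Lemma nth_rem_at (T : Type) (x0 : T) i l m : (i < size l)%N ->
  nth x0 (rem_at i l) m = nth x0 l (bump i m).
Proof.
move=> il; rewrite nth_cat size_take il /bump.
case: leqP => im /=; last by rewrite nth_take.
by rewrite nth_drop add1n addSn subnKC.
Qed.

Lemma all_rem_at (T : Type) (P : pred T) i l : all P l -> all P (rem_at i l).
Proof.
elim: l i => [|x l IH] [|i] //= /andP[Px Pl]; first by rewrite /rem_at /= drop0.
by rewrite /rem_at /= Px; exact: IH.
Qed.

Lemma subseq_combs (T : eqType) (l s : seq T) :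
  subseq l s -> l \in combs (size l) s.
Proof.
elim: s l => [|x s IH] [|y l] //=.
case: eqVneq => [-> /IH ls|_ /IH]; rewrite mem_cat.
  by rewrite map_f.
by move=> ->; rewrite orbT.
Qed.

Lemma sorted_subseq_iota n l : sorted ltn l -> all (fun i => i < n)%N l ->
  subseq l (iota 0 n).
Proof.
move=> sl /allP ln; have -> : l = [seq i <- iota 0 n | i \in l].
  apply: (irr_sorted_eq ltn_trans ltnn) => //.
    by rewrite sorted_filter ?iota_ltn_sorted //; exact: ltn_trans.
  move=> i; rewrite mem_filter mem_iota andbC.
  by case: (boolP (i \in l)) => [/ln ->|]; rewrite ?andbF.
exact: filter_subseq.
Qed.

(** Turns the sum over index functions in [hodge_fun] into one over an explicit list, which can be
    computed. *)
Lemma sum_ffun_words (T : nmodType) n k (F : seq nat -> T) :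
  \sum_(f : {ffun 'I_k -> 'I_n}) F [seq val (f j) | j <- enum 'I_k] =
  \sum_(l <- words n k) F l.
Proof.
elim: k F => [|k IH] F /=.
  rewrite big_seq1 (eq_bigr (fun=> F [::])) => [|f _].
    by rewrite sumr_const card_ffun !card_ord expn0.
  by rewrite enum_ord0.
rewrite big_flatten big_map -[iota 0 n]val_enum_ord big_map big_enum /=.
under [RHS]eq_bigr do rewrite big_map.
under [RHS]eq_bigr do rewrite -IH.
rewrite pair_big /=.
pose h (p : 'I_n * {ffun 'I_k -> 'I_n}) : {ffun 'I_k.+1 -> 'I_n} :=
  [ffun i => oapp p.2 p.1 (unlift ord0 i)].
rewrite (reindex h) /=; last first.
  exists (fun f => (f ord0, [ffun i => f (lift ord0 i)])) => [[x f] _|f _] /=.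
    rewrite /h ffunE unlift_none; congr (_, _).
    by apply/ffunP => i; rewrite !ffunE liftK.
  apply/ffunP => i; rewrite /h ffunE; case: unliftP => [j|] -> //=.
  by rewrite ffunE.
apply: eq_bigr => -[x f] _; rewrite enum_ordSl /= /h ffunE unlift_none /=.
rewrite -map_comp; congr (F (_ :: _)); apply: eq_map => j /=.
by rewrite ffunE liftK.
Qed.

(** * Values of forms on the vectors of a basis *)

Section BasisValues.
Variables (R : realType) (V : vectType R) (n : nat) (E : n.-tuple V).
Hypothesis basisE : basis_of {:V} E.

Definition btup k (l : seq nat) : 'I_k -> V := fun i => E`_(nth 0%N l i).

Lemma fcons_btup k j l : fcons E`_j (btup l) = btup (j :: l) :> ('I_k.+1 -> V).
Proof.
by apply/funext => i; rewrite /fcons /btup; case: unliftP => [m|] ->.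
Qed.

Lemma btup_lift k (l : seq nat) (i : 'I_k.+1) : size l = k.+1 ->
  btup l \o lift i = btup (rem_at i l) :> ('I_k -> V).
Proof. by move=> sl; apply/funext => m; rewrite /btup /= nth_rem_at ?sl. Qed.

Lemma fcat_btup k m (l1 l2 : seq nat) : size l1 = k ->
  fcat (btup l1) (btup l2) = btup (l1 ++ l2) :> ('I_(k + m) -> V).
Proof.
move=> sl; apply/funext => i; rewrite /fcat /btup.
case: split_ordP => j -> /=; rewrite nth_cat sl ?ltn_ord //.
by rewrite ltnNge leq_addr addKn.
Qed.

Lemma form_fcons_coord k (w : altform V k.+1) x v :
  w (fcons x v) = \sum_(j < n) coord E j x * w (fcons E`_j v).
Proof.
rewrite {1}(coord_basis basisE (memvf x)).
exact: (fcons_sum w (fun j : 'I_n => coord E j x) (fun j : 'I_n => E`_j)).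
Qed.

(** Expand the first argument in the basis and apply induction to the interior products with the
    basis vectors. *)
Lemma form_eq0_btup k (w : altform V k) :
  (forall l, size l = k -> all (fun i => i < n)%N l -> w (btup l) = 0) ->
  forall v, w v = 0.
Proof.
elim: k w => [|k IH] w w0 v.
  by rewrite -(w0 [::]) //; congr (form_fun w _); apply/funext => -[].
rewrite (fconsE v) form_fcons_coord big1 // => j _.
have wj u : iotaf E`_j w u = 0.
  apply: IH => l sl ln; rewrite /= fcons_btup w0 //= ?sl //.
  by rewrite ltn_ord.
by have /= -> := wj (v \o lift ord0); rewrite mulr0.
Qed.

(* Sorting the indices changes an alternating form only by a sign. *)
Lemma form_ext_combs k (w1 w2 : altform V k) :
  (forall l, l \in combs k (iota 0 n) -> w1 (btup l) = w2 (btup l)) -> w1 = w2.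
Proof.
move=> w12; apply/subr0_eq/form_ext; apply: form_eq0_btup => l sl ln.
set w := w1 - w2.
have w0 : forall l, l \in combs k (iota 0 n) -> w (btup l) = 0.
  by move=> l' /w12 e; rewrite /w /= !fctE /= e subrr.
have [ul|] := boolP (uniq l); last first.
  move/(uniqPn 0%N) => [i [j [ij jl lij]]]; rewrite sl in jl.
  apply: (@form_alt _ _ _ w _ (Ordinal (ltn_trans ij jl)) (Ordinal jl)).
    by rewrite -val_eqE /= ltn_eqF.
  by rewrite /btup /= lij.
have /eqP st : size (sort leq l) == k by rewrite size_sort sl.
have : perm_eq l (Tuple (introT eqP st)) by rewrite /= perm_sym perm_sort.
move/tuple_permP => [s ls].
have -> : btup l = btup (sort leq l) \o s :> ('I_k -> V).
  apply/funext => i; rewrite /btup /= {1}ls /=.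
  by rewrite (nth_map i) ?size_enum_ord // (nth_ord_enum i i) (tnth_nth 0%N).
rewrite form_perm w0 ?mulr0 // -{1}st subseq_combs //.
apply: sorted_subseq_iota; last by rewrite all_sort.
by rewrite ltn_sorted_uniq_leq sort_uniq ul sort_sorted //; exact: leq_total.
Qed.

End BasisValues.

(** * Integer coefficients of phi, psi and vol, and the identities computed on them *)

Definition sumz (T : Type) (s : seq T) (f : T -> int) : int :=
  foldr (fun x acc => f x + acc) 0 s.

Definition signz (m : nat) (z : int) : int := if odd m then - z else z.

(* The indices of the coframe in s start at 1, those of the frame in l at 0:
   cdet s l is the value of e^s at the frame vectors E`_i, for i in l. *)
Fixpoint cdet (s l : seq nat) : int :=
  if s is i :: s' then
    sumz (iota 0 (size l)) (fun m =>
      if nth 0%N l m == i.-1 then signz m (cdet s' (rem_at m l)) else 0)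
  else 1.

Definition phi_coef (l : seq nat) : int :=
  cdet [:: 1; 2; 7]%N l + cdet [:: 3; 4; 7]%N l + cdet [:: 5; 6; 7]%N l
  + cdet [:: 1; 3; 5]%N l - cdet [:: 1; 4; 6]%N l - cdet [:: 2; 3; 6]%N l
  - cdet [:: 2; 4; 5]%N l.

Definition psi_coef (l : seq nat) : int :=
  cdet [:: 1; 2; 3; 4]%N l + cdet [:: 1; 2; 5; 6]%N l + cdet [:: 1; 3; 6; 7]%N l
  + cdet [:: 1; 4; 5; 7]%N l + cdet [:: 2; 3; 5; 7]%N l
  - cdet [:: 2; 4; 6; 7]%N l + cdet [:: 3; 4; 5; 6]%N l.

Definition vol_coef (l : seq nat) : int := cdet [:: 1; 2; 3; 4; 5; 6; 7]%N l.

(** The factor 6 is 3!: [words 7 3] runs over ordered triples, like the sum in [hodge_fun] before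
    its division by 3!. *)
Lemma psi_coef_hodge : all (fun l =>
    sumz (words 7 3) (fun a =>
      let c := phi_coef a in if c == 0 then 0 else c * vol_coef (a ++ l))
    == 6%:Z * psi_coef l) (combs 4 (iota 0 7)).
Proof. by vm_compute. Qed.

(* Tabulated because quad_coef_cross looks the coefficients up some 10^5 times. *)
Definition phi_tab := Eval vm_compute in
  [seq [seq [seq phi_coef [:: a; b; c] | c <- iota 0 7] | b <- iota 0 7]
  | a <- iota 0 7].

Definition phi_at a b c : int := nth 0 (nth [::] (nth [::] phi_tab a) b) c.

Definition psi_tab := Eval vm_compute in
  [seq [seq [seq [seq psi_coef [:: a; b; c; d] | d <- iota 0 7] | c <- iota 0 7]
  | b <- iota 0 7] | a <- iota 0 7].

Definition psi_at a b c d : int :=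
  nth 0 (nth [::] (nth [::] (nth [::] psi_tab a) b) c) d.

Definition psi_on l := psi_at (nth 0 l 0) (nth 0 l 1) (nth 0 l 2) (nth 0 l 3).

Lemma psi_onE : all (fun l => psi_coef l == psi_on l) (words 7 4).
Proof. by vm_compute. Qed.

(** Twice the value of iota_{E_r} iota_{E_p} psi /\ iota_{E_q} psi on the frame vectors indexed by
    [f]: the sum in [wedge23] without its factor 1/2. *)
Definition quad_coef (p q r : nat) (f : seq nat) : int :=
  sumz (iota 0 5) (fun i => signz i (sumz (iota 0 4) (fun j => signz j (
    let c := psi_at p r (nth 0%N f i) (nth 0%N (rem_at i f) j) in
    if c == 0 then 0 else c * psi_on (q :: rem_at j (rem_at i f)))))).

(** The value vol(E_p, E_q x E_r, ...) on the frame vectors indexed by [f]. *)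
Definition cross_coef (p q r : nat) (f : seq nat) : int :=
  sumz (iota 0 7) (fun m =>
    let c := phi_at q r m in
    if c == 0 then 0 else c * vol_coef [:: p, m & f]).

(** The first identity, polarized in X. The constant is -4 = 2 * (-2), as [quad_coef] is a doubled
    value; by symmetry only p <= q is checked. *)
Lemma quad_coef_cross : all (fun f => all (fun p => all (fun q => all (fun r =>
    quad_coef p q r f + quad_coef q p r f ==
    - 4%:Z * (cross_coef p q r f + cross_coef q p r f))
    (iota 0 7)) (iota p (7 - p))) (iota 0 7)) (combs 5 (iota 0 7)).
Proof. by vm_compute. Qed.

(** The E_k component of E_p x (E_q x E_r). *)
Definition cross_sq_coef (p q r k : nat) : int :=
  sumz (iota 0 7) (fun m => phi_at p m k * phi_at q r m).

Definition krond (i j : nat) : int := if i == j then 1 else 0.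

Lemma krondC i j : krond i j = krond j i.
Proof. by rewrite /krond eq_sym. Qed.

(** Polarization in X of X x (X x Y) = <X, Y> X - |X|^2 Y. *)
Lemma cross_sq_coefE : all (fun p => all (fun q => all (fun r => all (fun k =>
    cross_sq_coef p q r k + cross_sq_coef q p r k ==
    (krond p r * krond q k + krond q r * krond p k)
    - 2%:Z * (krond p q * krond r k))
    (iota 0 7)) (iota 0 7)) (iota 0 7)) (iota 0 7).
Proof. by vm_compute. Qed.

Lemma antisym_phi_at : all (fun p => all (fun q => all (fun k =>
    phi_at p q k + phi_at q p k == 0)
    (iota 0 7)) (iota 0 7)) (iota 0 7).
Proof. by vm_compute. Qed.

Lemma mem_words n k l : size l = k -> all (fun i => i < n)%N l ->
  l \in words n k.
Proof.
elim: k l => [[]|k IH [|x l] //= [sl] /andP[xn ln]] //.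
by apply/allpairsP; exists (x, l); rewrite mem_iota /= xn IH.
Qed.

Lemma combs_iotaP n k l : l \in combs k (iota 0 n) ->
  size l = k /\ all (fun i => i < n)%N l.
Proof.
have -> : all (fun i => i < n)%N l = all (fun i => i \in iota 0 n) l.
  by apply: eq_all => i; rewrite mem_iota.
elim: (iota 0 n) k l => [|x s IH] [|k] l //=; rewrite ?inE; try by move/eqP->.
rewrite mem_cat => /orP[/mapP[l' /IH[sl' l's] ->]|/IH[sl ls]] /=.
  rewrite sl' inE eqxx; split=> //; apply/allP => y /(allP l's).
  by rewrite inE orbC => ->.
by split=> //; apply/allP => y /(allP ls); rewrite inE orbC => ->.
Qed.

(** * Passage from integer to real sums, and quadratic sums *)

Section Sums.
Variable R : realType.

(** This and the next three lemmas carry the identities computed over [int] to [R]. *)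
Lemma intr_sumz (T : Type) (s : seq T) (f : T -> int) :
  (sumz s f)%:~R = \sum_(x <- s) (f x)%:~R :> R.
Proof.
by elim: s => [|x s IH]; rewrite ?big_nil ?big_cons //= rmorphD /= IH.
Qed.

Lemma intr_sumz_iota n (f : nat -> int) :
  (sumz (iota 0 n) f)%:~R = \sum_(i < n) (f i)%:~R :> R.
Proof.
rewrite intr_sumz -(big_mkord xpredT (fun i => (f i)%:~R)).
by rewrite /index_iota subn0.
Qed.

Lemma intr_signz m z : (signz m z)%:~R = (-1) ^+ m * z%:~R :> R.
Proof.
rewrite /signz -signr_odd; case: odd; last by rewrite mul1r.
by rewrite rmorphN expr1 mulN1r.
Qed.

Lemma intr_skip0 (c d : int) :
  (if c == 0 then 0 else c * d)%:~R = c%:~R * d%:~R :> R.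
Proof. by case: eqP => [->|]; rewrite ?mul0r // rmorphM. Qed.

Lemma sum_krondl n (i : 'I_n) (F : 'I_n -> R) :
  \sum_(r < n) (krond i r)%:~R * F r = F i.
Proof.
rewrite (bigD1 i) //= big1 => [|j ji]; rewrite /krond ?eqxx ?mul1r ?addr0 //.
by rewrite val_eqE eq_sym (negPf ji) mul0r.
Qed.

Variables (I : finType) (x : I -> R).

(** A quadratic form depends only on the symmetric part of its coefficients, which is why the
    computed identities may be symmetrized. *)
Lemma quad_sum_eq (A B : I -> I -> R) :
  (forall p q, A p q + A q p = B p q + B q p) ->
  \sum_p \sum_q x p * x q * A p q = \sum_p \sum_q x p * x q * B p q.
Proof.
move=> AB.
have dbl C : 2%:R * (\sum_p \sum_q x p * x q * C p q) =
    \sum_p \sum_q x p * x q * (C p q + C q p).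
  rewrite mulr_natl mulr2n {2}exchange_big -big_split /=; apply: eq_bigr => p _.
  by rewrite -big_split; apply: eq_bigr => q _; rewrite /= mulrDr (mulrC (x q)).
apply: (@mulfI _ 2%:R); first by rewrite pnatr_eq0.
by rewrite !dbl; apply: eq_bigr => p _; apply: eq_bigr => q _; rewrite AB.
Qed.

(** Moves the signed sums of [wedge23] inside the double sum over the two slots of X. *)
Lemma quad_sum_comb (J : finType) (s F : J -> R)
    (G : J -> I -> I -> R) :
  (forall j, F j = \sum_p \sum_q x p * x q * G j p q) ->
  \sum_j s j * F j = \sum_p \sum_q x p * x q * \sum_j s j * G j p q.
Proof.
move=> FG; under eq_bigr do rewrite FG mulr_sumr.
rewrite exchange_big; apply: eq_bigr => p _; under eq_bigr do rewrite mulr_sumr.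
rewrite exchange_big; apply: eq_bigr => q _; rewrite mulr_sumr.
by apply: eq_bigr => j _; rewrite mulrCA.
Qed.

Lemma quad_sum_mul (a b : I -> R) :
  (\sum_p x p * a p) * (\sum_q x q * b q) =
  \sum_p \sum_q x p * x q * (a p * b q).
Proof.
rewrite big_distrlr; apply: eq_bigr => p _; apply: eq_bigr => q _ /=.
by rewrite mulrACA.
Qed.

End Sums.

Lemma formD (R : realType) (V : vectType R) k (w1 w2 : altform V k) v :
  (w1 + w2) v = w1 v + w2 v.
Proof. by []. Qed.

Lemma formN (R : realType) (V : vectType R) k (w : altform V k) v :
  (- w) v = - w v.
Proof. by []. Qed.

(** * Coframe monomials on frame vectors *)

Section CoframeValues.
Variables (R : realType) (V : vectType R) (n : nat) (E : n.+1.-tuple V).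
Hypothesis basisE : basis_of {:V} E.

(** Both sides expand along the first factor: the form by [wedge_coframe], [cdet] by its
    recursion. *)
Lemma coframe_btup (s l : seq nat) : size l = size s ->
  all (fun i => i.-1 < n.+1)%N s -> all (fun i => i < n.+1)%N l ->
  coframe_form E s (btup E l) = (cdet s l)%:~R.
Proof.
elim: s l => [|i s IH] l //= sl /andP[isn sn] ln.
rewrite -[LHS]/(wedge (coframe E (inord i.-1)) (coframe_form E s) (btup E l)).
rewrite wedge_coframe sl intr_sumz_iota; apply: eq_bigr => m _.
rewrite btup_lift // IH //; last 2 first.
- by rewrite (@size_rem_at _ _ _ (size s)).
- exact: all_rem_at.
have lm : (nth 0%N l m < n.+1)%N by apply: (allP ln); rewrite mem_nth ?sl.
rewrite /btup -[E`_(nth 0%N l m)]/(E`_(Ordinal lm)).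
rewrite coord_free ?(basis_free basisE) //.
rewrite -val_eqE /= inordK //; case: eqP => _; last by rewrite mul0r mulr0.
by rewrite mul1r intr_signz.
Qed.

End CoframeValues.

(** With [l] the five indices other than i and j, vol(E_p, E_q, E_l) vanishes unless {p, q} = {i,
    j}. Multiplied by the sign of (i, j, l), it is the (i, j) minor of E_p and E_q. *)
Lemma vol_coef_dual : all (fun i => all (fun j => (i == j) ||
    (let l := [seq m <- iota 0 7 | (m != i) && (m != j)] in
     all (fun p => all (fun q =>
       vol_coef [:: p, q & l] * vol_coef [:: i, j & l] ==
       krond p i * krond q j - krond p j * krond q i)
     (iota 0 7)) (iota 0 7)))
  (iota 0 7)) (iota 0 7).
Proof. by vm_compute. Qed.

(** * Pullbacks, and the trace of a scalar map *)

Section PullbackTheory.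
Variables (R : realType) (V W : vectType R) (f : {linear V -> W}).

Lemma pullback_wedge k l (a : altform W k) (b : altform W l) :
  pullback f (wedge a b) = wedge (pullback f a) (pullback f b).
Proof. exact: form_ext. Qed.

Lemma pullback_iota k x (w : altform W k.+1) :
  pullback f (iotaf (f x) w) = iotaf x (pullback f w).
Proof.
apply: form_ext => v /=; congr (form_fun w _); apply/funext => i.
by rewrite /fcons /=; case: unliftP.
Qed.

End PullbackTheory.

Lemma trace_scale (R : realType) (V : vectType R) (a : R) :
  trace (a *: \1%VF : 'End(V)) = a *+ \dim {:V}.
Proof.
rewrite /trace linearZ /= mxof1 ?(basis_free (vbasisP _)) //.
by rewrite scalemx1 mxtrace_scalar.
Qed.

(** * The forms phi, psi and vol of an adapted frame *)

Section G2Frame.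
Variables (R : realType) (g : lieAlgType R) (E : 7.-tuple g).
Hypothesis basisE : basis_of {:g} E.
Let vol : altform g 7 := coframe_form E [:: 1; 2; 3; 4; 5; 6; 7]%N.
Let psi : altform g 4 := g2_dual E (g2_form E).

Lemma vol_btup l : size l = 7 -> all (fun i => i < 7)%N l ->
  vol (btup E l) = (vol_coef l)%:~R.
Proof.
by move=> sl ln; exact: (coframe_btup basisE (s := [:: 1; 2; 3; 4; 5; 6; 7]%N)).
Qed.

Lemma g2_form_btup l : size l = 3 -> all (fun i => i < 7)%N l ->
  g2_form E (btup E l) = (phi_coef l)%:~R.
Proof.
move=> sl ln; rewrite /g2_form /phi_coef !formD !formN !rmorphD !rmorphN.
by congr (_ + _ + _ + _ - _ - _ - _);
  exact: (coframe_btup basisE (s := [:: _; _; _])).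
Qed.

Definition psi_form : altform g 4 :=
  coframe_form E [:: 1; 2; 3; 4]%N + coframe_form E [:: 1; 2; 5; 6]%N
  + coframe_form E [:: 1; 3; 6; 7]%N
  + coframe_form E [:: 1; 4; 5; 7]%N + coframe_form E [:: 2; 3; 5; 7]%N
  - coframe_form E [:: 2; 4; 6; 7]%N
  + coframe_form E [:: 3; 4; 5; 6]%N.

Lemma psi_form_btup l : size l = 4 -> all (fun i => i < 7)%N l ->
  psi_form (btup E l) = (psi_coef l)%:~R.
Proof.
move=> sl ln; rewrite /psi_form /psi_coef !formD formN !rmorphD rmorphN.
by congr (_ + _ + _ + _ + _ - _ + _);
  exact: (coframe_btup basisE (s := [:: _; _; _; _])).
Qed.

Lemma g2_dualE : psi = psi_form.
Proof.
apply: (form_ext_combs basisE) => l lc; have [sl ln] := combs_iotaP lc.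
rewrite psi_form_btup //.
pose F a : R := g2_form E (btup E a) * vol (btup E (a ++ l)).
transitivity (6%:R^-1 * \sum_(a <- words 7 3) F a).
  congr (_ * _); rewrite -sum_ffun_words; apply: eq_bigr => f _.
  have fE : (fun j => E`_(f j)) = btup E [seq val (f j) | j <- enum 'I_3].
    apply/funext => j.
    by rewrite /btup (nth_map j) ?size_enum_ord // (nth_ord_enum j j).
  by rewrite fE fcat_btup // size_map size_enum_ord.
move/allP: psi_coef_hodge => /(_ l lc)/eqP/(congr1 (fun z : int => z%:~R : R)).
rewrite intr_sumz rmorphM /= => psiE.
apply: (@mulfI _ 6%:R); first by rewrite pnatr_eq0.
rewrite -[6%:R in RHS]/((6%:Z)%:~R) -psiE mulrA mulfV ?mul1r ?pnatr_eq0 //.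
rewrite !big_seq; apply: eq_bigr => a aw.
have sa : size a = 3 /\ all (fun i => i < 7)%N a.
  have /allP/(_ a aw)/andP[/eqP] // :
    all (fun a => (size a == 3) && all (fun i => i < 7)%N a) (words 7 3).
    by vm_compute.
case: sa => sa an; rewrite intr_skip0 /F g2_form_btup // vol_btup //.
  by rewrite size_cat sa sl.
by rewrite all_cat an.
Qed.

(** * The G2 cross product and its square *)

Definition cross X Y : g := \sum_(k < 7)
  (\sum_(p < 7) \sum_(q < 7) coord E p X * coord E q Y * (phi_at p q k)%:~R)
  *: E`_k.

(** As [E] is orthonormal, this coordinate is phi(X, Y, E_k), so that [cross] is the usual cross
    product. *)
Lemma coord_cross k X Y : coord E k (cross X Y) =
  \sum_(p < 7) \sum_(q < 7) coord E p X * coord E q Y * (phi_at p q k)%:~R.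
Proof. by rewrite coord_sum_free ?(basis_free basisE). Qed.

Lemma coord_inj X Y : (forall k, coord E k X = coord E k Y) -> X = Y.
Proof.
move=> XY; rewrite (coord_basis basisE (memvf X)).
rewrite (coord_basis basisE (memvf Y)).
by apply: eq_bigr => k _; rewrite XY.
Qed.

Fact cross_linear X : linear (cross X).
Proof.
move=> a Y Z; rewrite /cross scaler_sumr -big_split; apply: eq_bigr => k _ /=.
rewrite scalerA -scalerDl mulr_sumr -big_split; congr (_ *: _).
apply: eq_bigr => p _ /=; rewrite mulr_sumr -big_split.
apply: eq_bigr => q _ /=.
by rewrite linearP /=; ring.
Qed.

HB.instance Definition _ X := GRing.isSemilinear.Build R g g _ (cross X)
  (GRing.semilinear_linear (cross_linear X)).

Lemma mem_iota7 (i : 'I_7) : (i : nat) \in iota 0 7.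
Proof. by rewrite mem_iota /=. Qed.

(** Makes Y |-> X x Y descend to the quotient by X. *)
Lemma crossXX X : cross X X = 0.
Proof.
apply: coord_inj => k; rewrite coord_cross linear0.
rewrite (@quad_sum_eq _ _ _ _ (fun _ _ => 0)) => [|p q].
  by rewrite big1 // => p _; rewrite big1 // => q _; rewrite mulr0.
rewrite -rmorphD /=; move/allP: antisym_phi_at => /(_ _ (mem_iota7 p)).
move/allP=> /(_ _ (mem_iota7 q))/allP/(_ _ (mem_iota7 k))/eqP ->.
by rewrite addr0.
Qed.

Lemma cross_cross X Y : cross X (cross X Y) =
  (\sum_(i < 7) coord E i X * coord E i Y) *: X
  - (\sum_(i < 7) coord E i X ^+ 2) *: Y.
Proof.
apply: coord_inj => k; rewrite coord_cross linearB !linearZ /=.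
pose x i := coord E i X; pose y i := coord E i Y.
transitivity (\sum_(p < 7) \sum_(q < 7) x p * x q *
    \sum_(r < 7) y r * (cross_sq_coef p q r k)%:~R).
  apply: eq_bigr => p _; under eq_bigr do rewrite coord_cross.
  under eq_bigr do rewrite -mulrA mulr_suml mulr_sumr.
  rewrite exchange_big; apply: eq_bigr => q _ /=.
  under eq_bigr do rewrite mulr_suml mulr_sumr.
  rewrite exchange_big mulr_sumr; apply: eq_bigr => r _ /=.
  rewrite intr_sumz_iota !mulr_sumr; apply: eq_bigr => m _.
  by rewrite rmorphM /= -/(x p) -/(x q) -/(y r); ring.
(* The new coefficients are not symmetric in p and q; their symmetrization is the right side of
   [cross_sq_coefE]. *)
rewrite (@quad_sum_eq _ _ _ _ (fun p q : 'I_7 => \sum_(r < 7) y r *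
    ((krond p r)%:~R * (krond q k)%:~R -
     (krond p q)%:~R * (krond r k)%:~R))) => [|p q].

  transitivity (\sum_(p < 7) \sum_(q < 7) x p * x q *
      (y p * (krond q k)%:~R - (krond p q)%:~R * y k)).
    apply: eq_bigr => p _; apply: eq_bigr => q _; congr (_ * _).
    rewrite -(sum_krondl p (fun r => y r * (krond q k)%:~R)).
    rewrite -(sum_krondl k y) mulr_sumr -sumrB.
    by apply: eq_bigr => r _; rewrite (krondC r k); ring.
  rewrite !mulr_suml -sumrB; apply: eq_bigr => p _ /=.
  rewrite -[coord E k X]/(x k) -(sum_krondl k x) -/(x p) -/(y p) -/(y k).
  have -> : x p ^+ 2 * y k = \sum_(q < 7) (krond p q)%:~R * (x p * x q * y k).
    by rewrite (sum_krondl p (fun q => x p * x q * y k)) expr2.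
  rewrite mulr_sumr -sumrB; apply: eq_bigr => q _.
  by rewrite (krondC q k); ring.
rewrite -!big_split; apply: eq_bigr => r _ /=.
rewrite -!mulrDr -rmorphD; congr (_ * _).
move/allP: cross_sq_coefE => /(_ _ (mem_iota7 p))/allP/(_ _ (mem_iota7 q)).
move/allP=> /(_ _ (mem_iota7 r))/allP/(_ _ (mem_iota7 k))/eqP ->.
by rewrite !(rmorphD, rmorphN, rmorphM) /= (krondC q p); ring.
Qed.

(** * Contractions of psi and vol with X and Y *)

Lemma psi1_btup X l : size l = 3 -> all (fun i => i < 7)%N l ->
  iotaf X psi (btup E l) =
  \sum_(p < 7) coord E p X * (psi_on ((p : nat) :: l))%:~R.
Proof.
move=> sl ln; rewrite [LHS](form_fcons_coord basisE) g2_dualE.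
apply: eq_bigr => p _.
rewrite fcons_btup psi_form_btup //= ?sl ?ltn_ord //.
have /(allP psi_onE)/eqP -> // : (p : nat) :: l \in words 7 4.
by apply: mem_words; rewrite /= ?sl ?ltn_ord.
Qed.

Lemma psi2_btup X Y l : size l = 2 -> all (fun i => i < 7)%N l ->
  iotaf Y (iotaf X psi) (btup E l) = \sum_(p < 7) coord E p X *
    \sum_(r < 7) coord E r Y * (psi_on [:: p : nat, r : nat & l])%:~R.
Proof.
move=> sl ln; rewrite [LHS](form_fcons_coord basisE).
transitivity (\sum_(r < 7) \sum_(p < 7)
    coord E p X * (coord E r Y * (psi_on [:: p : nat, r : nat & l])%:~R)).
  apply: eq_bigr => r _; rewrite fcons_btup psi1_btup //= ?sl ?ltn_ord //.
  by rewrite mulr_sumr; apply: eq_bigr => p _; rewrite mulrCA.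
by rewrite exchange_big; apply: eq_bigr => p _; rewrite mulr_sumr.
Qed.

Lemma wedge_iota_psi X Y :
  wedge (iotaf Y (iotaf X psi)) (iotaf X psi) =
  iotaf (- 2%:R *: cross X Y) (iotaf X vol).
Proof.
apply: (form_ext_combs basisE) => l lc; have [sl ln] := combs_iotaP lc.
pose x i := coord E i X; pose y i := coord E i Y.
have lift_lt (i : 'I_5) : all (fun i => i < 7)%N (rem_at i l).
  exact: all_rem_at.
have nth_lt (s : seq nat) i :
    all (fun i => i < 7)%N s -> (i < size s)%N -> (nth 0%N s i < 7)%N.
  by move=> /allP sn si; apply: sn; rewrite mem_nth.
have sl4 (i : 'I_5) : size (rem_at i l) = 4 by exact: size_rem_at.
pose G (i : 'I_5) (j : 'I_4) (p q : 'I_7) : R :=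
  (\sum_(r < 7) y r * (psi_at p r (nth 0%N l i) (nth 0%N (rem_at i l) j))%:~R) *
  (psi_on ((q : nat) :: rem_at j (rem_at i l)))%:~R.
(* The left side as a quadratic form in X with coefficients linear in Y; 1/2 is the factor of
   [wedge23]. *)
transitivity (\sum_(p < 7) \sum_(q < 7) x p * x q *
    (2%:R^-1 * \sum_(r < 7) y r * (quad_coef p q r l)%:~R)).
  rewrite wedge23.
  transitivity (2%:R^-1 * \sum_(i < 5) (-1) ^+ i * (\sum_(j < 4) (-1) ^+ j *
    \sum_p \sum_q x p * x q * G i j p q)).
    congr (_ * _); apply: eq_bigr => i _; congr (_ * _); apply: eq_bigr => j _.
    congr (_ * _); rewrite -quad_sum_mul; congr (_ * _); last first.
      rewrite !btup_lift // psi1_btup //; first exact: size_rem_at.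
      exact: all_rem_at.
    have -> : fcons (btup E l i) (fcons (btup E l (lift i j)) (fun=> 0)) =
        btup E [:: nth 0%N l i; nth 0%N (rem_at i l) j] :> ('I_2 -> g).
      apply/funext => m; rewrite -[RHS]/(btup E _ m) -!fcons_btup.
      rewrite /fcons; case: (unliftP ord0 m) => //= m' _.
      case: (unliftP ord0 m') => [[]|] //= _.
      by rewrite /btup nth_rem_at ?sl.
    by rewrite psi2_btup //= !nth_lt ?sl ?sl4.
  under eq_bigr => i _.
    rewrite (quad_sum_comb (fun j : 'I_4 => (-1) ^+ j) (fun j => erefl)); over.
  rewrite (quad_sum_comb (fun i : 'I_5 => (-1) ^+ i) (fun i => erefl)).
  rewrite mulr_sumr; apply: eq_bigr => p _.
  rewrite mulr_sumr; apply: eq_bigr => q _.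
  rewrite mulrCA; congr (_ * (_ * _)).
  transitivity (\sum_(i < 5) \sum_(j < 4) \sum_(r < 7)
    y r * ((-1) ^+ i * ((-1) ^+ j *
    ((psi_at p r (nth 0%N l i) (nth 0%N (rem_at i l) j))%:~R *
     (psi_on ((q : nat) :: rem_at j (rem_at i l)))%:~R)))).
    apply: eq_bigr => i _; rewrite mulr_sumr; apply: eq_bigr => j _.
    rewrite /G mulr_suml !mulr_sumr; apply: eq_bigr => r _; ring.
  under eq_bigr do rewrite exchange_big.
  rewrite exchange_big; apply: eq_bigr => r _.
  rewrite /quad_coef intr_sumz_iota mulr_sumr.
  apply: eq_bigr => i _; rewrite intr_signz intr_sumz_iota !mulr_sumr.
  by apply: eq_bigr => j _; rewrite intr_signz intr_skip0.
(* Here -2 is 1/2 times the -4 of [quad_coef_cross]. *)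
rewrite (@quad_sum_eq _ _ _ _ (fun p q : 'I_7 =>
    - 2%:R * \sum_(r < 7) y r * (cross_coef p q r l)%:~R)) => [|p q].
  have crossE : - 2%:R *: cross X Y = \sum_(m < 7) (- 2%:R *
      \sum_(p < 7) \sum_(q < 7) x p * y q * (phi_at p q m)%:~R) *: E`_m.
    by rewrite scaler_sumr; apply: eq_bigr => m _; rewrite scalerA.
  rewrite crossE -[RHS]/(iotaf X vol (fcons _ _)) fcons_sum.
  transitivity (\sum_(m < 7) \sum_(p < 7) \sum_(q < 7) \sum_(r < 7)
    x p * x q * (- 2%:R * (y r * ((phi_at q r m)%:~R *
      (vol_coef [:: p : nat, m : nat & l])%:~R)))).
    rewrite [RHS]exchange_big; apply: eq_bigr => p _.
    rewrite [RHS]exchange_big; apply: eq_bigr => q _.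
    rewrite [RHS]exchange_big !mulr_sumr; apply: eq_bigr => r _.
    rewrite /cross_coef intr_sumz_iota !mulr_sumr; apply: eq_bigr => m _.
    by rewrite intr_skip0.
  apply: eq_bigr => m _.
  rewrite fcons_btup [X in _ = _ * X](form_fcons_coord basisE) mulr_sumr.
  apply: eq_bigr => p _; rewrite fcons_btup vol_btup; last 2 first.
  - by rewrite /= sl.
  - by rewrite /= !ltn_ord.
  rewrite mulr_sumr mulr_suml; apply: eq_bigr => q _.
  rewrite mulr_sumr mulr_suml; apply: eq_bigr => r _.
  by rewrite -/(x p) -/(x q) -/(y r); ring.
rewrite -!mulrDr -!big_split !mulr_sumr; apply: eq_bigr => r _ /=.
rewrite -!mulrDr -!rmorphD.
have key (a b : 'I_7) : (a <= b)%N ->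
    quad_coef a b r l + quad_coef b a r l =
    - 4%:Z * (cross_coef a b r l + cross_coef b a r l).
  move=> ab; move/allP: quad_coef_cross.
  move=> /(_ l lc)/allP/(_ _ (mem_iota7 a))/allP.
  have bi : (b : nat) \in iota a (7 - a).
    by rewrite mem_iota ab subnKC ?ltn_ord // ltnW.
  by move=> /(_ _ bi)/allP/(_ _ (mem_iota7 r))/eqP.
have -> : quad_coef p q r l + quad_coef q p r l =
    - 4%:Z * (cross_coef p q r l + cross_coef q p r l).
  case: (leqP p q) => pq; first exact: key.
  rewrite (addrC (quad_coef p q r l)) (addrC (cross_coef p q r l)).
  exact: key (ltnW pq).
by move: (cross_coef p q r l + _) => c; rewrite rmorphM rmorphN /=; field.
Qed.
Lemma vol2_btup X Y l : size l = 5 -> all (fun i => i < 7)%N l ->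
  iotaf Y (iotaf X vol) (btup E l) = \sum_(p < 7) \sum_(q < 7)
    coord E p X * coord E q Y * (vol_coef [:: p : nat, q : nat & l])%:~R.
Proof.
move=> sl ln; rewrite [LHS](form_fcons_coord basisE) exchange_big.
apply: eq_bigr => q _; rewrite fcons_btup.
rewrite [X in _ * X](form_fcons_coord basisE) mulr_sumr; apply: eq_bigr => p _.
rewrite fcons_btup vol_btup; last 2 first.
- by rewrite /= sl.
- by rewrite /= !ltn_ord.
by rewrite mulrA (mulrC (coord E q Y)).
Qed.

(** Contraction with vol is injective on bivectors, so X /\ Y = 0: all 2 by 2 minors of the
    coordinates vanish. *)
Lemma iota_vol_eq0 X Y : X != 0 -> iotaf Y (iotaf X vol) = 0 -> Y \in <[X]>%VS.
Proof.
move=> X0 XY0; pose x i := coord E i X; pose y i := coord E i Y.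
have xyE i j : x i * y j = x j * y i.
  have [->//|ij] := eqVneq i j.
  pose l := [seq m <- iota 0 7 | (m != i :> nat) && (m != j :> nat)].
  have [sl ln] : size l = 5 /\ all (fun m => m < 7)%N l.
    have /allP/(_ _ (mem_iota7 i))/allP/(_ _ (mem_iota7 j)) :
      all (fun i => all (fun j =>
      (i == j) || (let l := [seq m <- iota 0 7 | (m != i) && (m != j)] in
       (size l == 5) && all (fun m => m < 7)%N l)) (iota 0 7)) (iota 0 7).
      by vm_compute.
    by rewrite val_eqE (negPf ij) => /andP[/eqP].
  have dual (p q : 'I_7) :
      vol_coef [:: p : nat, q : nat & l] * vol_coef [:: i : nat, j : nat & l] =
      krond p i * krond q j - krond p j * krond q i.
    move/allP: vol_coef_dual => /(_ _ (mem_iota7 i))/allP/(_ _ (mem_iota7 j)).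
    rewrite val_eqE (negPf ij).
    by move=> /allP/(_ _ (mem_iota7 p))/allP/(_ _ (mem_iota7 q))/eqP.
  clearbody l.
  have : iotaf Y (iotaf X vol) (btup E l) *
      (vol_coef [:: i : nat, j : nat & l])%:~R = 0.
    by rewrite XY0 mul0r.
  rewrite vol2_btup // => S0.
  (* The zero becomes the expanded contraction again; Kronecker deltas spread the minor over the
     same double sum, and the terms agree by [dual]. *)
  apply/eqP; rewrite -subr_eq0; apply/eqP; rewrite -{}[RHS]S0.
  rewrite -(sum_krondl i (fun p => x p * y j)).
  rewrite -(sum_krondl j (fun p => x p * y i)) -sumrB.
  rewrite mulr_suml; apply: eq_bigr => p _ /=.
  rewrite -(sum_krondl j (fun q => (krond i p)%:~R * (x p * y q))) -/(x p).
  rewrite -(sum_krondl i (fun q => (krond j p)%:~R * (x p * y q))) -sumrB.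
  rewrite mulr_suml; apply: eq_bigr => q _; rewrite -/(y q).
  rewrite -[RHS]mulrA -intrM dual rmorphB !rmorphM /=.
  by rewrite !(krondC i) !(krondC j); ring.
have [i xi0] : exists i, x i != 0.
  apply/existsP; apply: contraNT X0; rewrite negb_exists => /forallP x0.
  apply/eqP/coord_inj => i; rewrite linear0.
  by apply/eqP; rewrite -[_ == _]negbK x0.
apply/vlineP; exists (y i / x i); apply: coord_inj => j.
rewrite linearZ /= -/(x j) -/(y j); apply: (mulfI xi0).
by rewrite xyE; field.
Qed.

(** * The map K_rho on the quotient by X *)

Variable X : g.
Hypothesis X0 : X != 0.
Local Notation h := (quotv <[X]>%VS).
Local Notation pi := (@quotv_pi R g <[X]>%VS).
Let rho : altform h 3 := pushforward <[X]>%VS (iotaf X psi).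
Let nu : altform h 6 := pushforward <[X]>%VS (iotaf X vol).

(** [Kmap] is a choice, so two things are needed: the induced map satisfies the defining equation,
    and that equation determines the value because a vector is determined by its contraction with
    nu. *)
Lemma Kmap_rho Y : Kmap nu rho (pi Y) = pi (- 2%:R *: cross X Y).
Proof.
pose L := linfun (cross X); pose P := linfun pi.
(* [P^-1] is a linear section of the surjection [P]; another lift differs by a multiple of X, which
   [cross X] kills. *)
pose K : 'End(h) := (- 2%:R *: (P \o L \o P^-1))%VF.
have piE Z1 Z2 : (pi Z1 == pi Z2) = (Z1 - Z2 \in <[X]>%VS) by exact: quotv_piE.
have PK q : pi (P^-1%VF q) = q.
  have /limg_lfunVK : q \in limg P.
    rewrite -(quotv_reprK q) -[quotv_pi _ _]/(pi _) -(lfunE pi).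
    by rewrite memv_img ?memvf.
  by rewrite lfunE.
have KE Z : K (pi Z) = pi (- 2%:R *: cross X Z).
  rewrite /K scale_lfunE !comp_lfunE !lfunE /= linearZ; congr (_ *: _).
  apply/eqP; rewrite piE -linearB /=.
  have /eqP := PK (pi Z); rewrite piE => /vlineP[c ->].
  by rewrite linearZ /= crossXX // scaler0 mem0v.
have KP q : iotaf (K q) nu = wedge (iotaf q rho) rho.
  rewrite -(quotv_reprK q) -[quotv_pi _ _]/(pi _) KE.
  apply: pullback_quotv_inj; rewrite [RHS](pullback_wedge pi (iotaf _ rho) rho).
  by rewrite !pullback_iota !pushforward_iotaK wedge_iota_psi.
have : forall q, iotaf (Kmap nu rho q) nu = wedge (iotaf q rho) rho.
  apply: (@xgetPex _ 0 [set K : 'End(h) | forall q,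
    iotaf (K q) nu = wedge (iotaf q rho) rho]%classic).
  by exists K.
(* Uniqueness: equal contractions with nu pull back to equal contractions with iota_X vol, so the
   representatives differ by a multiple of X. *)
move=> /(_ (pi Y)); rewrite -KP -KE.
move: (Kmap nu rho (pi Y)) (K (pi Y)) => q1 q2.
rewrite -(quotv_reprK q1) -(quotv_reprK q2) -![quotv_pi _ _]/(pi _).
move/(congr1 (fun w : altform h 5 => pullback pi w)).
rewrite !pullback_iota !pushforward_iotaK => e12.
apply/eqP; rewrite piE; apply: iota_vol_eq0 => //; apply: form_ext => v.
rewrite addrC -scaleN1r; apply: etrans (fcons_linear (iotaf X vol) v _ _ _) _.
have -> : iotaf X vol (fcons (generic_quotient.repr q1) v) =
    iotaf X vol (fcons (generic_quotient.repr q2) v).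
  exact: (congr1 (fun w : altform g 5 => form_fun w v) e12).
by rewrite mulN1r addNr.
Qed.

Lemma sqnorm_gt0 : 0 < \sum_(i < 7) coord E i X ^+ 2.
Proof.
rewrite lt_def sumr_ge0 ?andbT => [|i _]; last exact: sqr_ge0.
apply: contraNneq X0 => /psumr_eq0P x0; apply/eqP/coord_inj => i.
by rewrite linear0; apply/eqP; rewrite -sqrf_eq0 x0 // => j _; exact: sqr_ge0.
Qed.

Lemma Lambda_minus_rho : Lambda_minus rho.
Proof.
have ngX : ~~ ({:g} <= <[X]>)%VS.
  by apply/negP => /dimvS; rewrite dim_vline X0 (size_basis basisE).
have nunz : nu != 0.
  (* If nu were zero, so would be iota_X vol, and every Y would lie on the line of X. *)
  apply: contraNneq ngX => nu0; apply/subvP => Y _; apply: iota_vol_eq0 => //.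
  by rewrite -(pushforward_iotaK X vol) -/nu nu0; exact: form_ext.
(* Ensures that a negative multiple of the identity has negative trace. *)
have dimh : (0 < \dim {:h})%N.
  rewrite lt0n; apply: contra ngX; rewrite dimv_eq0 => /eqP h0.
  apply/subvP => Y _; have := memvf (pi Y); rewrite h0 memv0 -(linear0 pi).
  by rewrite quotv_piE subr0.
exists nu => //.
have -> : lambda nu rho = 6%:R^-1 *
    trace ((- 4%:R * \sum_(i < 7) coord E i X ^+ 2) *: \1%VF : 'End(h)).
  congr (_ * trace _); apply/lfunP => q.
  rewrite comp_lfunE scale_lfunE id_lfunE.
  rewrite -(quotv_reprK q) -[quotv_pi _ _]/(pi _) !Kmap_rho.
  move: (generic_quotient.repr q) => Y.
  rewrite [cross X (_ *: _)]linearZ /= cross_cross //.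
  rewrite -[RHS]linearZ; apply/eqP; rewrite quotv_piE; apply/vlineP.
  (* The coefficient of X in 4 X x (X x Y), the part that dies in the quotient. *)
  exists (4%:R * \sum_(i < 7) coord E i X * coord E i Y).
  rewrite /= !scalerBr !scalerA -addrA -opprD -scalerDl.
  rewrite [X in _ - X *: _](_ : _ = 0) ?scale0r ?subr0; last by ring.
  by congr (_ *: _); ring.
rewrite trace_scale pmulr_rlt0 ?invr_gt0 ?ltr0n // pmulrn_llt0 //.
rewrite mulNr oppr_lt0.
by rewrite mulr_gt0 ?ltr0n ?sqnorm_gt0.
Qed.

End G2Frame.

Theorem corollary9 (R : realType) (g : lieAlgType R)
    (dim_g : \dim {:g} = 7%N)
    (o : set (altform g (\dim {:g}))) (o_orientation : orientation o)
    (nontrivial_center : exists Z : g, Z != 0 /\ central Z)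
    (hX : exists X : g, [/\ X != 0, central X &
       forall kappa : altform g 4, d_closed kappa ->
         ~ Lambda_minus (pushforward <[X]>%VS (iotaf X kappa))]) :
  ~ exists phi : altform g 3, G2_structure phi /\ coclosed phi.
Proof.
(* The adapted frame is the one supplied by coclosedness, so that psi computed in it is the closed
   form. *)
move=> [phi [_ [E [basisE ->] closed]]]; case: hX => X [X0 _ notLm].
exact: notLm closed (Lambda_minus_rho basisE X0).
Qed.
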